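(* $$5\sqrt{2} = \sum_{k=0}^{\infty}\left(-\frac14\right)^{k}\frac{\left(-\frac18\right)_k\left(\frac14\right)_k\left(\frac38\right)_k}{(1)_k\left(\frac98\right)_k\left(\frac{13}{8}\right)_k}\,(40k+7).$$
   Context: For $k\in\mathbb{N}_0$, $(\alpha)_k=\alpha(\alpha+1)\cdots(\alpha+k-1)$ is the rising factorial (Pochhammer symbol), with $(\alpha)_0=1$. *)

(* Defs.v *)
From Stdlib Require Import Reals.
From Coquelicot Require Import Coquelicot.
Open Scope R_scope.

Fixpoint rising_fact (a : R) (k : nat) : R :=
  match k with
  | O => 1
  | S j => rising_fact a j * (a + INR j)
  end.

(* Main.v *)
Require Import Defs.
From Stdlib Require Import Reals Lra Lia Psatz.
From Coquelicot Require Import Coquelicot.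
Open Scope R_scope.

(** With [t = y^4] and [x = y^8 / 4], the [k]-th term is [d_k m_k (40 k + 7)], where
    [sum d_k y^(8k) = (1 + x)^(-1/4)] and, for [k >= 1], the factor
    [m_k = (-1/4)_(2k) / (9/4)_(2k)] is proportional to the Beta integral of
    [y^(8k-2) (1 - y^4)^(3/2)] over [0, 1].  Summing under the integral leaves, up to exact
    differentials, the form [t^(-5/4) (1-t)^(1/2) (1 + t^2/4)^(-1/4) (2 + 3t) dt].
    The substitution [s / (1-s)^2 = t / ((1-t)^2 (4 + t^2))], which sends [0, 1] to [0, 1]
    and behaves like [t / 4] at [0], turns it into [sqrt 2 s^(-5/4) (1-s)^(1/2) ds], which
    is again a multiple of the same Beta integral.  With [t = 2 sinh u] the substitution is
    [s = e^(3u) (e^u - 1) / (e^u + 1)]; below [sigma = s^(1/4) = y e^u / sqrt (1 + e^u)]. *)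

(** * Integration of derivatives and continuity of real functions *)

(** The function [f z - RInt g a z] is continuous on the closed interval with zero derivative
    inside, so the mean value theorem equates its end values. Nothing is asked of the derivative of
    [f] at the ends, where the primitives below involve [sqrt (1 - y^4)] at 1 or a division by [y]
    at 0. *)
Lemma is_RInt_derive_interior (f g : R -> R) (a b : R) :
  a < b ->
  (forall x, a <= x <= b -> continuous f x) ->
  (forall x, continuous g x) ->
  (forall x, a < x < b -> is_derive f x (g x)) ->
  is_RInt g a b (f b - f a).
Proof.
  intros Hab Cf Cg Df.
  assert (Ig : forall x y, ex_RInt g x y) by
    (intros x y; apply (ex_RInt_continuous (V := R_CompleteNormedModule)); intros; apply Cg).
  assert (DI : forall x, is_derive (fun z => RInt g a z) x (g x)).
  { intros x. apply (is_derive_RInt (V := R_NormedModule) g (fun z => RInt g a z) a).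
    - apply filter_forall; intros z; apply (RInt_correct (V := R_CompleteNormedModule)), Ig.
    - apply Cg. }
  destruct (MVT_gen (fun z => f z - RInt g a z) a b (fun _ => 0)) as [c [_ Hc]].
  - intros x Hx. rewrite Rmin_left, Rmax_right in Hx by lra.
    replace 0 with (g x - g x) by ring.
    apply (is_derive_minus (V := R_NormedModule)); [apply Df; lra | apply DI].
  - intros x Hx. rewrite Rmin_left, Rmax_right in Hx by lra.
    apply continuity_pt_filterlim.
    apply (continuous_minus (V := R_NormedModule)).
    + apply Cf; lra.
    + apply (ex_derive_continuous (V := R_NormedModule)). exists (g x); apply DI.
  - assert (E : RInt g a b = f b - f a).
    { assert (Z : RInt g a a = 0) by apply (RInt_point (V := R_CompleteNormedModule)). rewrite Z in Hc. lra. }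
    rewrite <- E. apply (RInt_correct (V := R_CompleteNormedModule)), Ig.
Qed.

Lemma continuous_of_ex_derive (f : R -> R) (x : R) : ex_derive f x -> continuous f x.
Proof. apply (ex_derive_continuous (V := R_NormedModule)). Qed.

Lemma continuous_Rplus (f g : R -> R) (x : R) :
  continuous f x -> continuous g x -> continuous (fun y => f y + g y) x.
Proof. apply (continuous_plus (V := R_NormedModule)). Qed.

Lemma continuous_Rminus (f g : R -> R) (x : R) :
  continuous f x -> continuous g x -> continuous (fun y => f y - g y) x.
Proof. apply (continuous_minus (V := R_NormedModule)). Qed.

Lemma continuous_Rmult (f g : R -> R) (x : R) :
  continuous f x -> continuous g x -> continuous (fun y => f y * g y) x.
Proof. apply (continuous_mult (K := R_AbsRing)). Qed.

(** * Beta integrals *)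

Definition sqrt_one_minus_pow4 (y : R) : R := sqrt (1 - y ^ 4).

Lemma pow_unit_lt_1 (y : R) (n : nat) : 0 <= y < 1 -> 0 <= y ^ S n < 1.
Proof.
  intros Hy. induction n as [|n IH]; simpl in *; [lra|].
  split; [apply Rmult_le_pos; lra|].
  assert (y * (y * y ^ n) <= y * 1) by (apply Rmult_le_compat_l; lra). lra.
Qed.

Lemma continuous_sqrt_one_minus_pow4 (y : R) : continuous sqrt_one_minus_pow4 y.
Proof.
  apply (continuous_comp (fun z => 1 - z ^ 4) sqrt).
  - apply continuous_of_ex_derive. auto_derive. trivial.
  - apply continuous_sqrt.
Qed.

Lemma sqrt_one_minus_pow4_sqr (y : R) : 0 <= y <= 1 ->
  sqrt_one_minus_pow4 y * sqrt_one_minus_pow4 y = 1 - y ^ 4.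
Proof.
  intros Hy. apply sqrt_sqrt.
  assert (y ^ 4 <= 1 ^ 4) by (apply pow_incr; lra). lra.
Qed.

Lemma sqrt_one_minus_pow4_pos (y : R) : 0 <= y < 1 -> 0 < sqrt_one_minus_pow4 y.
Proof.
  intros Hy. pose proof (pow_unit_lt_1 y 3 ltac:(lra)). apply sqrt_lt_R0; lra.
Qed.

(* The derivative [- 2 y^3 / r], [r = sqrt (1 - y^4)], is written so as to be linear in [r]. *)
Lemma is_derive_sqrt_one_minus_pow4 (y : R) : 0 <= y < 1 ->
  is_derive sqrt_one_minus_pow4 y (- 2 * y ^ 3 * sqrt_one_minus_pow4 y / (1 - y ^ 4)).
Proof.
  intros Hy. pose proof (pow_unit_lt_1 y 3 ltac:(lra)) as H4.
  rewrite <- sqrt_one_minus_pow4_sqr by lra.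
  pose proof (sqrt_one_minus_pow4_pos y Hy) as Pos.
  unfold sqrt_one_minus_pow4 in *. auto_derive.
  - simpl in H4. lra.
  - replace (1 + - (y * (y * (y * (y * 1))))) with (1 - y ^ 4) by ring.
    field. lra.
Qed.

(** In the variable [t = y^4] this is [B((p+1)/4, 5/2) / 4]. *)
Definition moment (p : nat) : R :=
  RInt (fun y => y ^ p * ((1 - y ^ 4) * sqrt_one_minus_pow4 y)) 0 1.

Lemma continuous_moment_integrand (p : nat) (y : R) :
  continuous (fun y => y ^ p * ((1 - y ^ 4) * sqrt_one_minus_pow4 y)) y.
Proof.
  apply continuous_Rmult; [|apply continuous_Rmult; [|apply continuous_sqrt_one_minus_pow4]];
    apply continuous_of_ex_derive; auto_derive; trivial.
Qed.

Lemma is_RInt_moment (p : nat) :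
  is_RInt (fun y => y ^ p * ((1 - y ^ 4) * sqrt_one_minus_pow4 y)) 0 1 (moment p).
Proof.
  apply (RInt_correct (V := R_CompleteNormedModule)).
  apply (ex_RInt_continuous (V := R_CompleteNormedModule)).
  intros; apply continuous_moment_integrand.
Qed.

(** The function [y^(p+1) (1 - y^4)^(5/2)] vanishes at both ends, and its derivative is the
    combination of the two integrands. *)
Lemma moment_add4 (p : nat) : (INR p + 11) * moment (p + 4) = (INR p + 1) * moment p.
Proof.
  assert (H : is_RInt (fun y => (INR p + 1) * (y ^ p * ((1 - y ^ 4) * sqrt_one_minus_pow4 y))
      - (INR p + 11) * (y ^ (p + 4) * ((1 - y ^ 4) * sqrt_one_minus_pow4 y))) 0 1
      ((INR p + 1) * moment p - (INR p + 11) * moment (p + 4))).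
  { apply (is_RInt_minus (V := R_NormedModule));
    apply (is_RInt_scal (V := R_NormedModule)), is_RInt_moment. }
  assert (H' : is_RInt (fun y => (INR p + 1) * (y ^ p * ((1 - y ^ 4) * sqrt_one_minus_pow4 y))
      - (INR p + 11) * (y ^ (p + 4) * ((1 - y ^ 4) * sqrt_one_minus_pow4 y))) 0 1
      (1 ^ (S p) * (1 - 1 ^ 4) ^ 2 * sqrt_one_minus_pow4 1
       - 0 ^ (S p) * (1 - 0 ^ 4) ^ 2 * sqrt_one_minus_pow4 0)).
  { apply (is_RInt_derive_interior (fun y => y ^ (S p) * (1 - y ^ 4) ^ 2 * sqrt_one_minus_pow4 y)).
    - lra.
    - intros y _.
      apply continuous_Rmult; [|apply continuous_sqrt_one_minus_pow4].
      apply continuous_of_ex_derive. auto_derive. trivial.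
    - intros y.
      apply continuous_Rminus; apply continuous_Rmult;
        first [apply continuous_const | apply continuous_moment_integrand].
    - intros y Hy.
      pose proof (is_derive_sqrt_one_minus_pow4 y ltac:(lra)) as D.
      pose proof (pow_unit_lt_1 y 3 ltac:(lra)) as H4.
      auto_derive.
      + eexists; exact D.
      + rewrite (is_derive_unique (fun x : R => sqrt_one_minus_pow4 x) _ _ D).
        replace (match p with O => 1 | S _ => INR p + 1 end) with (INR p + 1) by (destruct p; simpl; ring).
        rewrite pow_add. simpl in H4. field. lra. }
  pose proof (is_RInt_unique _ _ _ _ H) as E1. pose proof (is_RInt_unique _ _ _ _ H') as E2.
  rewrite E1 in E2. simpl in E2. rewrite !Rmult_1_l in E2.  lra.
Qed.

(** The quotient is the difference quotient of [f] at 0, and its value there is [0 * / 0 = 0], equal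
    to the derivative. *)
Lemma continuous_div_of_is_derive_0 (f : R -> R) :
  f 0 = 0 -> is_derive f 0 0 -> continuous (fun y => f y / y) 0.
Proof.
  intros f0 D. apply is_derive_Reals in D.
  apply continuity_pt_filterlim.
  intros eps Heps. destruct (D eps Heps) as [delta Hd].
  exists delta. split; [apply cond_pos|].
  intros y [[_ Hy] Hdist]. simpl in *. unfold R_dist in *.
  specialize (Hd y ltac:(auto)). rewrite Rminus_0_r in Hdist. specialize (Hd Hdist).
  rewrite Rplus_0_l, f0, !Rminus_0_r in Hd.
  rewrite f0. unfold Rdiv at 2. rewrite Rmult_0_l, Rminus_0_r. exact Hd.
Qed.

(** [area 1] is [B(3/4, 3/2) / 4], the unit in which the other integrals are expressed. The variable
    upper limit lets [area] enter a primitive both at [y] and at [sigma y]. *)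
Definition area (z : R) : R := RInt (fun y => y ^ 2 * sqrt_one_minus_pow4 y) 0 z.

Lemma continuous_area_integrand (y : R) :
  continuous (fun y => y ^ 2 * sqrt_one_minus_pow4 y) y.
Proof.
  apply continuous_Rmult; [|apply continuous_sqrt_one_minus_pow4].
  apply continuous_of_ex_derive. auto_derive. trivial.
Qed.

Lemma is_RInt_area (z : R) : is_RInt (fun y => y ^ 2 * sqrt_one_minus_pow4 y) 0 z (area z).
Proof.
  apply (RInt_correct (V := R_CompleteNormedModule)).
  apply (ex_RInt_continuous (V := R_CompleteNormedModule)).
  intros; apply continuous_area_integrand.
Qed.

Lemma is_derive_area (z : R) : is_derive area z (z ^ 2 * sqrt_one_minus_pow4 z).
Proof.
  apply (is_derive_RInt (V := R_NormedModule) (fun y => y ^ 2 * sqrt_one_minus_pow4 y) area 0).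
  - apply filter_forall, is_RInt_area.
  - apply continuous_area_integrand.
Qed.

Lemma area_1_pos : 0 < area 1.
Proof.
  apply RInt_gt_0.
  - lra.
  - intros y Hy. apply Rmult_lt_0_compat.
    + apply pow_lt; lra.
    + apply sqrt_one_minus_pow4_pos; lra.
  - intros; apply continuous_area_integrand.
Qed.

(** Integrate the derivative of [y^3 (1 - y^4)^(3/2)], writing [y^6 = y^2 - y^2 (1 - y^4)]. *)
Lemma moment_2 : 3 * moment 2 = 2 * area 1.
Proof.
  assert (H : is_RInt (fun y => 9 * (y ^ 2 * ((1 - y ^ 4) * sqrt_one_minus_pow4 y))
      - 6 * (y ^ 2 * sqrt_one_minus_pow4 y)) 0 1 (9 * moment 2 - 6 * area 1)).
  { apply (is_RInt_minus (V := R_NormedModule));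
    apply (is_RInt_scal (V := R_NormedModule)); [apply is_RInt_moment | apply is_RInt_area]. }
  assert (H' : is_RInt (fun y => 9 * (y ^ 2 * ((1 - y ^ 4) * sqrt_one_minus_pow4 y))
      - 6 * (y ^ 2 * sqrt_one_minus_pow4 y)) 0 1
      (1 ^ 3 * (1 - 1 ^ 4) * sqrt_one_minus_pow4 1
       - 0 ^ 3 * (1 - 0 ^ 4) * sqrt_one_minus_pow4 0)).
  { apply (is_RInt_derive_interior (fun y => y ^ 3 * (1 - y ^ 4) * sqrt_one_minus_pow4 y)).
    - lra.
    - intros y _.
      apply continuous_Rmult; [|apply continuous_sqrt_one_minus_pow4].
      apply continuous_of_ex_derive. auto_derive. trivial.
    - intros y.
      apply continuous_Rminus; apply continuous_Rmult;
        first [apply continuous_const | apply continuous_moment_integrand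
              | apply continuous_area_integrand].
    - intros y Hy.
      pose proof (is_derive_sqrt_one_minus_pow4 y ltac:(lra)) as D.
      pose proof (pow_unit_lt_1 y 3 ltac:(lra)) as H4.
      auto_derive.
      + eexists; exact D.
      + rewrite (is_derive_unique (fun x : R => sqrt_one_minus_pow4 x) _ _ D).
        simpl in H4. field. lra. }
  pose proof (is_RInt_unique _ _ _ _ H) as E1. pose proof (is_RInt_unique _ _ _ _ H') as E2.
  rewrite E1 in E2. simpl in E2. lra.
Qed.

(** * The substitution *)

(* [u] is defined by [sinh u = y^4 / 2]. *)
Definition cosh_u (y : R) : R := sqrt (1 + y ^ 8 / 4).
(** This is [(1 + x)^(-1/4)] at [x = y^8 / 4]. *)
Definition binom_weight (y : R) : R := / sqrt (cosh_u y).
Definition exp_u (y : R) : R := y ^ 4 / 2 + cosh_u y.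
Definition sigma (y : R) : R := y * (exp_u y / sqrt (1 + exp_u y)).

Lemma pow8_nonneg (y : R) : 0 <= y ^ 8.
Proof. replace (y ^ 8) with ((y ^ 4) ^ 2) by ring. apply pow2_ge_0. Qed.

Lemma cosh_u_sqr (y : R) : cosh_u y * cosh_u y = 1 + y ^ 8 / 4.
Proof. apply sqrt_sqrt. pose proof (pow8_nonneg y). lra. Qed.

Lemma cosh_u_ge_1 (y : R) : 1 <= cosh_u y.
Proof.
  rewrite <- sqrt_1. apply sqrt_le_1_alt. pose proof (pow8_nonneg y). lra.
Qed.

Lemma binom_weight_pos (y : R) : 0 < binom_weight y.
Proof. apply Rinv_0_lt_compat, sqrt_lt_R0. pose proof (cosh_u_ge_1 y). lra. Qed.

Lemma binom_weight_sqr (y : R) : binom_weight y * binom_weight y = / cosh_u y.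
Proof.
  pose proof (cosh_u_ge_1 y). unfold binom_weight. rewrite <- Rinv_mult, sqrt_sqrt; lra.
Qed.

Lemma exp_u_ge_1 (y : R) : 1 <= exp_u y.
Proof.
  pose proof (cosh_u_ge_1 y). unfold exp_u.
  assert (0 <= y ^ 4) by (replace (y ^ 4) with ((y ^ 2) ^ 2) by ring; apply pow2_ge_0). lra.
Qed.

(** This is [2 sinh u = e^u - e^(-u)]. With it [y^4] and [cosh_u y] become rational in [exp_u y],
    which reduces the identities for [sigma] to [field]. *)
Lemma pow4_exp_u (y : R) : y ^ 4 = exp_u y - / exp_u y.
Proof.
  pose proof (exp_u_ge_1 y). pose proof (cosh_u_sqr y).
  apply (Rmult_eq_reg_r (exp_u y)); [|lra].
  rewrite Rmult_minus_distr_r, Rinv_l by lra. unfold exp_u in *.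
  replace (y ^ 8) with (y ^ 4 * y ^ 4) in * by ring. nra.
Qed.

Lemma cosh_u_exp_u (y : R) : cosh_u y = (exp_u y + / exp_u y) / 2.
Proof. pose proof (pow4_exp_u y). unfold exp_u in *. lra. Qed.

Lemma is_derive_cosh_u (y : R) : is_derive cosh_u y (y ^ 7 / cosh_u y).
Proof.
  pose proof (cosh_u_ge_1 y). pose proof (pow8_nonneg y). unfold cosh_u in *. auto_derive.
  - simpl in *. lra.
  - match goal with |- context [sqrt ?a] => replace a with (1 + y ^ 8 / 4) by (simpl; field) end.
    field. lra.
Qed.

Lemma is_derive_binom_weight (y : R) :
  is_derive binom_weight y (- binom_weight y * y ^ 7 / (2 * (cosh_u y * cosh_u y))).
Proof.
  pose proof (cosh_u_ge_1 y). pose proof (is_derive_cosh_u y) as D.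
  assert (0 < sqrt (cosh_u y)) by (apply sqrt_lt_R0; lra).
  unfold binom_weight. auto_derive.
  - repeat split; try lra. eexists; exact D.
  - rewrite (is_derive_unique (fun x : R => cosh_u x) _ _ D).
    set (a := sqrt (cosh_u y)) in *. replace (cosh_u y) with (a * a) by (apply sqrt_sqrt; lra).
    field. lra.
Qed.

(** With [E = exp_u y], [sigma y ^ 4 = E^3 (E - 1) / (E + 1)], and the claim is the factorization [1
    + E + E^3 - E^4 = (1 + E - E^2) (1 + E^2)]. *)
Lemma sigma_pow4 (y : R) :
  1 - sigma y ^ 4 = (1 - y ^ 4) * (2 * cosh_u y) * (exp_u y / sqrt (1 + exp_u y)) ^ 2.
Proof.
  pose proof (exp_u_ge_1 y). unfold sigma.
  rewrite Rpow_mult_distr.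
  replace ((exp_u y / sqrt (1 + exp_u y)) ^ 4) with (((exp_u y / sqrt (1 + exp_u y)) ^ 2) ^ 2) by ring.
  replace ((exp_u y / sqrt (1 + exp_u y)) ^ 2) with (exp_u y ^ 2 / (1 + exp_u y)).
  - rewrite pow4_exp_u, cosh_u_exp_u. field. lra.
  - rewrite <- (sqrt_sqrt (1 + exp_u y)) at 1 by lra. field.
    apply Rgt_not_eq, sqrt_lt_R0; lra.
Qed.

Lemma is_derive_exp_u (y : R) : is_derive exp_u y (2 * y ^ 3 * exp_u y / cosh_u y).
Proof.
  pose proof (cosh_u_ge_1 y). pose proof (is_derive_cosh_u y) as D.
  unfold exp_u. auto_derive.
  - eexists; exact D.
  - rewrite (is_derive_unique (fun x : R => cosh_u x) _ _ D). field. lra.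
Qed.

(* The logarithmic derivative of [sigma] in terms of [t = y^4] is [(3 t + 2) / (4 t sqrt (4 + t^2))]. *)
Lemma is_derive_sigma (y : R) :
  is_derive sigma y (exp_u y / sqrt (1 + exp_u y) * (3 * y ^ 4 + 2) / (2 * cosh_u y)).
Proof.
  pose proof (exp_u_ge_1 y). pose proof (is_derive_exp_u y) as D.
  assert (Hs : 0 < sqrt (1 + exp_u y)) by (apply sqrt_lt_R0; lra).
  unfold sigma. auto_derive.
  - repeat split; try lra; eexists; exact D.
  - rewrite (is_derive_unique (fun x : R => exp_u x) _ _ D).
    assert (Ha := sqrt_sqrt (1 + exp_u y) ltac:(lra)).
    pose proof (cosh_u_ge_1 y).
    (* With [rho = exp_u y / sqrt (1 + exp_u y)], this is the product rule for [y * rho] in the form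
       [rho (1 + y rho' / rho)]. *)
    transitivity (exp_u y / sqrt (1 + exp_u y) * (1 + y ^ 4 * (2 + exp_u y) / (cosh_u y * (1 + exp_u y)))).
    + rewrite Ha. field. repeat split; lra.
    + assert (0 < exp_u y * exp_u y) by nra. rewrite pow4_exp_u, cosh_u_exp_u. field. repeat split; nra.
Qed.

Lemma sigma_pos (y : R) : 0 < y -> 0 < sigma y.
Proof.
  intros Hy. pose proof (exp_u_ge_1 y).
  apply Rmult_lt_0_compat; [lra|]. apply Rdiv_lt_0_compat; [lra|]. apply sqrt_lt_R0; lra.
Qed.

Lemma sigma_lt_1 (y : R) : 0 < y < 1 -> sigma y < 1.
Proof.
  intros Hy. pose proof (sigma_pow4 y) as K. pose proof (sigma_pos y ltac:(lra)) as Hp.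
  pose proof (pow_unit_lt_1 y 3 ltac:(lra)). pose proof (cosh_u_ge_1 y). pose proof (exp_u_ge_1 y).
  assert (0 < (1 - y ^ 4) * (2 * cosh_u y) * (exp_u y / sqrt (1 + exp_u y)) ^ 2).
  { apply Rmult_lt_0_compat.
    - apply Rmult_lt_0_compat; lra.
    - apply pow_lt, Rdiv_lt_0_compat; [lra|]. apply sqrt_lt_R0; lra. }
  destruct (Rlt_or_le (sigma y) 1) as [|Hle]; [assumption|].
  assert (1 ^ 4 <= sigma y ^ 4) by (apply pow_incr; lra). lra.
Qed.

Lemma sigma_1 : sigma 1 = 1.
Proof.
  pose proof (sigma_pow4 1) as K. pose proof (sigma_pos 1 ltac:(lra)) as Hp.
  assert ((sigma 1 - 1) * ((sigma 1 + 1) * (sigma 1 ^ 2 + 1)) = 0).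
  { replace ((sigma 1 - 1) * ((sigma 1 + 1) * (sigma 1 ^ 2 + 1))) with (- (1 - sigma 1 ^ 4)) by ring.
    rewrite K. ring. }
  assert (0 < (sigma 1 + 1) * (sigma 1 ^ 2 + 1)) by nra.
  destruct (Rmult_integral _ _ H); lra.
Qed.

(** The square root of [sigma_pow4], factor by factor. The factor [sqrt (2 * cosh_u y)] is the
    source of [sqrt 2] in the result. *)
Lemma sqrt_one_minus_pow4_sigma (y : R) : 0 <= y <= 1 ->
  sqrt_one_minus_pow4 (sigma y)
  = sqrt_one_minus_pow4 y * sqrt (2 * cosh_u y) * (exp_u y / sqrt (1 + exp_u y)).
Proof.
  intros Hy. pose proof (cosh_u_ge_1 y). pose proof (exp_u_ge_1 y).
  assert (0 < sqrt (1 + exp_u y)) by (apply sqrt_lt_R0; lra).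
  assert (y ^ 4 <= 1 ^ 4) by (apply pow_incr; lra).
  assert (0 < exp_u y / sqrt (1 + exp_u y)) by (apply Rdiv_lt_0_compat; lra).
  unfold sqrt_one_minus_pow4 at 1. rewrite sigma_pow4, sqrt_mult, sqrt_mult, sqrt_pow2; try lra.
  - reflexivity.
  - apply Rmult_le_pos; lra.
  - apply pow2_ge_0.
Qed.

(* This is [(5 y Q' + 7 (Q - 1)) / y^2] for [Q = binom_weight], with the division
   carried out so that it is continuous at [0]. *)
Definition closed_sum (y : R) : R :=
  y ^ 6 * (- (5 / 2) * binom_weight y / (cosh_u y * cosh_u y)
    - 7 / (4 * cosh_u y * (1 + cosh_u y) * (1 + binom_weight y))).

(** With [Q = binom_weight y] and [v = cosh_u y], rationalizing twice extracts [y^8] from [Q - 1]: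
    [Q^2 - 1 = (1 - v) / v] and [1 - v^2 = - y^8 / 4]. *)
Lemma sqr_mul_closed_sum (y : R) :
  y ^ 2 * closed_sum y = - (5 / 2) * y ^ 8 * binom_weight y / (cosh_u y * cosh_u y) + 7 * (binom_weight y - 1).
Proof.
  pose proof (binom_weight_pos y). pose proof (binom_weight_sqr y) as Hq. pose proof (cosh_u_ge_1 y). pose proof (cosh_u_sqr y) as Hv.
  assert (E : binom_weight y - 1 = - (y ^ 8 / 4) / (cosh_u y * (1 + cosh_u y) * (1 + binom_weight y))).
  { apply (Rmult_eq_reg_r (1 + binom_weight y)); [|lra].
    replace ((binom_weight y - 1) * (1 + binom_weight y)) with (binom_weight y * binom_weight y - 1) by ring.
    rewrite Hq. replace (y ^ 8 / 4) with (cosh_u y * cosh_u y - 1) by lra.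
    field. lra. }
  rewrite E. unfold closed_sum. field. lra.
Qed.

Lemma continuous_closed_sum (y : R) : continuous closed_sum y.
Proof.
  pose proof (binom_weight_pos y). pose proof (cosh_u_ge_1 y).
  assert (Dv : ex_derive cosh_u y) by (eexists; apply is_derive_cosh_u).
  assert (Dq : ex_derive binom_weight y) by (eexists; apply is_derive_binom_weight).
  apply continuous_of_ex_derive. unfold closed_sum. auto_derive.
  assert (0 < cosh_u y * cosh_u y) by nra.
  assert (0 < 4 * cosh_u y * (1 + cosh_u y) * (1 + binom_weight y)) by (repeat apply Rmult_lt_0_compat; lra).
  repeat split; first [assumption | apply Rgt_not_eq; assumption].
Qed.

(* At [y = 0] both quotients are [0] since [/ 0 = 0]; near [0] each blows up, but their
   combination tends to [0]. *)
Definition primitive (y : R) : R :=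
  (5 * binom_weight y + 7) * (1 - y ^ 4) * sqrt_one_minus_pow4 y / y + 42 * area y
  - 6 * sqrt 2 * ((1 - sigma y ^ 4) * sqrt_one_minus_pow4 (sigma y) / sigma y + 5 * area (sigma y)).

(** This integrates [s^(-5/4) (1-s)^(1/2) ds], up to a constant factor and with [s = z^4]: the
    non-integrable part at 0 goes into the boundary term, the rest is [area]. *)
Lemma is_derive_boundary_add_area (z : R) : 0 < z < 1 ->
  is_derive (fun z => (1 - z ^ 4) * sqrt_one_minus_pow4 z / z + 5 * area z) z
    (- sqrt_one_minus_pow4 z / z ^ 2).
Proof.
  intros Hz.
  pose proof (is_derive_sqrt_one_minus_pow4 z ltac:(lra)) as D.
  pose proof (is_derive_area z) as DA.
  pose proof (pow_unit_lt_1 z 3 ltac:(lra)) as H4.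
  auto_derive.
  - repeat split; try lra; eexists; eassumption.
  - rewrite (is_derive_unique (fun x : R => sqrt_one_minus_pow4 x) _ _ D).
    rewrite (is_derive_unique (fun x : R => area x) _ _ DA).
    simpl in H4. field. simpl. lra.
Qed.

(** With [Q = binom_weight y], the [sigma] part contributes [6 Q (3 y^4 + 2)]. The constants 42 and
    [6 * sqrt 2] are chosen so that [- (5 Q + 7) (1 + 5 y^4) + 42 y^4 + 6 Q (3 y^4 + 2) = 7 (Q - 1)
    (1 - y^4)]. *)
Lemma is_derive_primitive (y : R) : 0 < y < 1 ->
  is_derive primitive y ((1 - y ^ 4) * sqrt_one_minus_pow4 y * closed_sum y).
Proof.
  intros Hy.
  pose proof (is_derive_sqrt_one_minus_pow4 y ltac:(lra)) as Dr.
  pose proof (is_derive_area y) as DA.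
  pose proof (is_derive_binom_weight y) as Dq.
  pose proof (pow_unit_lt_1 y 3 ltac:(lra)) as H4.
  pose proof (sigma_pos y ltac:(lra)) as Hs.
  assert (D1 : is_derive (fun y => (5 * binom_weight y + 7) * (1 - y ^ 4) * sqrt_one_minus_pow4 y / y + 42 * area y) y
    (sqrt_one_minus_pow4 y / y ^ 2 * (- (5 / 2) * y ^ 8 * binom_weight y / (cosh_u y * cosh_u y) * (1 - y ^ 4)
      - (5 * binom_weight y + 7) * (1 + 5 * y ^ 4) + 42 * y ^ 4))).
  { pose proof (cosh_u_ge_1 y). auto_derive.
    - repeat split; try lra; eexists; eassumption.
    - rewrite (is_derive_unique (fun x : R => sqrt_one_minus_pow4 x) _ _ Dr).
      rewrite (is_derive_unique (fun x : R => area x) _ _ DA).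
      rewrite (is_derive_unique (fun x : R => binom_weight x) _ _ Dq).
      simpl in H4. field. simpl. lra. }
  assert (D2 := is_derive_comp (fun z : R => (1 - z ^ 4) * sqrt_one_minus_pow4 z / z + 5 * area z) sigma y _ _
    (is_derive_boundary_add_area (sigma y) (conj Hs (sigma_lt_1 y Hy))) (is_derive_sigma y)).
  apply (is_derive_scal _ _ (6 * sqrt 2)) in D2.
  pose proof (is_derive_minus (V := R_NormedModule) _ _ _ _ _ D1 D2) as D.
  unfold primitive.
  match type of D with is_derive _ _ ?a =>
    replace ((1 - y ^ 4) * sqrt_one_minus_pow4 y * closed_sum y) with a; [exact D|] end.
  pose proof (cosh_u_ge_1 y). pose proof (exp_u_ge_1 y).
  assert (Hr : sqrt_one_minus_pow4 (sigma y)
    = sqrt_one_minus_pow4 y * (sqrt 2 * sqrt (cosh_u y)) * (exp_u y / sqrt (1 + exp_u y))).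
  { rewrite <- sqrt_mult by lra. apply sqrt_one_minus_pow4_sigma. lra. }
  assert (0 < sqrt (1 + exp_u y)) by (apply sqrt_lt_R0; lra).
  assert (Hv : 0 < sqrt (cosh_u y)) by (apply sqrt_lt_R0; lra).
  assert (Hvv := sqrt_sqrt (cosh_u y) ltac:(lra)).
  assert (H2 := sqrt_sqrt 2 ltac:(lra)).
  set (rho := exp_u y / sqrt (1 + exp_u y)) in *.
  assert (0 < rho) by (apply Rdiv_lt_0_compat; lra).
  assert (Es : sigma y = y * rho) by reflexivity.
  (* The powers of [rho] cancel: one comes from the derivative of [sigma], one from the square root,
     and [sigma y ^ 2] has two. Also [sqrt (cosh_u y) / cosh_u y] is [binom_weight y]. *)
  assert (Z : 6 * sqrt 2 * (rho * (3 * y ^ 4 + 2) / (2 * cosh_u y) * (- sqrt_one_minus_pow4 (sigma y) / sigma y ^ 2))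
    = - (sqrt_one_minus_pow4 y / y ^ 2 * (6 * binom_weight y * (3 * y ^ 4 + 2)))).
  { rewrite Hr, Es, <- Hvv at 1. unfold binom_weight.
    transitivity (- (sqrt_one_minus_pow4 y / y ^ 2
        * (3 * (sqrt 2 * sqrt 2) * / sqrt (cosh_u y) * (3 * y ^ 4 + 2)))); [field; lra|].
    rewrite H2. ring. }
  match goal with |- ?a = ?b => change (@eq R a b) end.
  transitivity (sqrt_one_minus_pow4 y / y ^ 2 * (- (5 / 2) * y ^ 8 * binom_weight y / (cosh_u y * cosh_u y) * (1 - y ^ 4)
      - (5 * binom_weight y + 7) * (1 + 5 * y ^ 4) + 42 * y ^ 4)
    - 6 * sqrt 2 * (rho * (3 * y ^ 4 + 2) / (2 * cosh_u y) * (- sqrt_one_minus_pow4 (sigma y) / sigma y ^ 2))).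
  - reflexivity.
  - rewrite Z.
    transitivity (sqrt_one_minus_pow4 y / y ^ 2 * (1 - y ^ 4) * (y ^ 2 * closed_sum y)); [|field; lra].
    rewrite sqr_mul_closed_sum. field. lra.
Qed.

Lemma continuous_primitive (y : R) : 0 <= y <= 1 -> continuous primitive y.
Proof.
  intros Hy. pose proof (exp_u_ge_1 y) as He.
  assert (Cr : continuous (fun y => sqrt_one_minus_pow4 (sigma y)) y).
  { apply (continuous_comp sigma sqrt_one_minus_pow4).
    - apply continuous_of_ex_derive. eexists; apply is_derive_sigma.
    - apply continuous_sqrt_one_minus_pow4. }
  assert (Ca : continuous area y) by (apply continuous_of_ex_derive; eexists; apply is_derive_area).
  assert (Cas : continuous (fun y => area (sigma y)) y).
  { apply (continuous_comp sigma area); apply continuous_of_ex_derive; eexists;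
      [apply is_derive_sigma | apply is_derive_area]. }
  assert (Cq : continuous binom_weight y) by (apply continuous_of_ex_derive; eexists; apply is_derive_binom_weight).
  destruct (Req_dec y 0) as [->|Hy0].
  - (* Both boundary terms of [primitive] blow up like [12 / y]. *)
    pose (num := fun y => (5 * binom_weight y + 7) * (1 - y ^ 4) * sqrt_one_minus_pow4 y
      - 6 * sqrt 2 * ((1 - sigma y ^ 4) * sqrt_one_minus_pow4 (sigma y) * (sqrt (1 + exp_u y) / exp_u y))).
    assert (Cn : continuous (fun y => num y / y) 0).
    { assert (v0 : cosh_u 0 = 1) by (transitivity (sqrt 1); [unfold cosh_u; f_equal; field | apply sqrt_1]).
      assert (e0 : exp_u 0 = 1) by (unfold exp_u; rewrite v0; simpl; field).
      assert (q0 : binom_weight 0 = 1) by (unfold binom_weight; rewrite v0, sqrt_1; field).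
      assert (s0 : sigma 0 = 0) by (unfold sigma; ring).
      assert (r0 : sqrt_one_minus_pow4 0 = 1)
        by (transitivity (sqrt 1); [unfold sqrt_one_minus_pow4; f_equal; ring | apply sqrt_1]).
      assert (H2 := sqrt_sqrt 2 ltac:(lra)).
      (* The value of [num] at 0 is [12 - 6 * sqrt 2 * sqrt 2 = 0]. Its derivative there vanishes
         since each factor varies only through [y^4], [y^8] or [sigma y ^ 4]. *)
      apply continuous_div_of_is_derive_0.
      - unfold num. rewrite s0, q0, r0, e0. simpl.
        replace (1 + 1) with 2 by ring. lra.
      - pose proof (is_derive_sqrt_one_minus_pow4 0 ltac:(lra)) as Dr.
        pose proof (is_derive_binom_weight 0) as Dq. pose proof (is_derive_exp_u 0) as De.
        pose proof (is_derive_sigma 0) as Ds.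
        assert (Drs := Dr). rewrite <- s0 in Drs at 1.
        unfold num. auto_derive.
        + repeat split; try (rewrite e0; lra); try (eexists; eassumption).
        + rewrite (is_derive_unique (fun x : R => sqrt_one_minus_pow4 x) _ _ Drs).
          rewrite (is_derive_unique (fun x : R => sqrt_one_minus_pow4 x) _ _ Dr).
          rewrite (is_derive_unique (fun x : R => binom_weight x) _ _ Dq).
          rewrite (is_derive_unique (fun x : R => exp_u x) _ _ De).
          rewrite s0. unfold Rdiv. ring. }
    (* The two expressions agree at [y = 0] too, because the inverse of a product is the product of
       inverses even when a factor is 0. *)
    apply (continuous_ext (fun y => num y / y + 42 * area y - 30 * sqrt 2 * area (sigma y))).
    { intros y. match goal with |- ?a = ?b => change (@eq R a b) end.
      unfold num, primitive, sigma, Rdiv. rewrite !Rinv_mult, Rinv_inv. ring. }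
    apply continuous_Rminus; [apply continuous_Rplus; [exact Cn|]|];
      apply continuous_Rmult; first [apply continuous_const | assumption].
  - pose proof (sigma_pos y ltac:(lra)).
    assert (Cs : continuous sigma y) by (apply continuous_of_ex_derive; eexists; apply is_derive_sigma).
    assert (Ds : ex_derive sigma y) by (eexists; apply is_derive_sigma).
    assert (Dq : ex_derive binom_weight y) by (eexists; apply is_derive_binom_weight).
    assert (Cr0 := continuous_sqrt_one_minus_pow4 y).
    assert (C1 : continuous (fun y => (5 * binom_weight y + 7) * (1 - y ^ 4)) y)
      by (apply continuous_of_ex_derive; auto_derive; assumption).
    assert (C2 : continuous (fun y => 1 - sigma y ^ 4) y)
      by (apply continuous_of_ex_derive; auto_derive; assumption).
    assert (C3 : continuous (fun y => / y) y)
      by (apply continuous_of_ex_derive; auto_derive; lra).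
    assert (C4 : continuous (fun y => / sigma y) y)
      by (apply continuous_of_ex_derive; auto_derive; repeat split; first [assumption | lra]).
    unfold primitive, Rdiv.
    apply continuous_Rminus; [apply continuous_Rplus|].
    + apply continuous_Rmult; [apply continuous_Rmult; assumption|assumption].
    + apply continuous_Rmult; [apply continuous_const|assumption].
    + apply continuous_Rmult; [apply continuous_const|].
      apply continuous_Rplus; apply continuous_Rmult;
        [apply continuous_Rmult; assumption|assumption|apply continuous_const|assumption].
Qed.

(** At 1 the boundary terms vanish and [sigma 1 = 1], leaving [42 * area 1 - 30 * sqrt 2 * area 1];
    at 0 the primitive is 0 by the convention [/ 0 = 0]. *)
Lemma is_RInt_closed_sum :
  is_RInt (fun y => (1 - y ^ 4) * sqrt_one_minus_pow4 y * closed_sum y) 0 1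
    (6 * area 1 * (7 - 5 * sqrt 2)).
Proof.
  assert (r1 : sqrt_one_minus_pow4 1 = 0).
  { unfold sqrt_one_minus_pow4. rewrite <- sqrt_0. f_equal. ring. }
  assert (s0 : sigma 0 = 0) by (unfold sigma; ring).
  assert (a0 : area 0 = 0) by apply (RInt_point (V := R_CompleteNormedModule)).
  replace (6 * area 1 * (7 - 5 * sqrt 2)) with (primitive 1 - primitive 0).
  - apply is_RInt_derive_interior.
    + lra.
    + apply continuous_primitive.
    + intros y. apply continuous_Rmult; [|apply continuous_closed_sum].
      apply continuous_Rmult; [|apply continuous_sqrt_one_minus_pow4].
      apply continuous_of_ex_derive. auto_derive. trivial.
    + apply is_derive_primitive.
  - unfold primitive. rewrite s0, sigma_1, r1, a0. unfold Rdiv. rewrite Rinv_0. ring.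
Qed.

(** * Summation under the integral *)

Lemma rising_fact_pos (a : R) (k : nat) : 0 < a -> 0 < rising_fact a k.
Proof.
  intros Ha. induction k as [|k IH]; simpl; [lra|].
  apply Rmult_lt_0_compat; [exact IH|]. pose proof (pos_INR k). lra.
Qed.

(* By duplication the left-hand side is [(-1/4)_(2k+2) / (9/4)_(2k+2)], a ratio of Beta values. *)
Lemma rising_fact_ratio_moment (k : nat) :
  rising_fact (- (1 / 8)) (S k) * rising_fact (3 / 8) (S k)
    / (rising_fact (9 / 8) (S k) * rising_fact (13 / 8) (S k))
  = - / (6 * area 1) * moment (8 * k + 6).
Proof.
  pose proof area_1_pos.
  induction k as [|k IH].
  - pose proof (moment_add4 2) as E. simpl in *. pose proof moment_2 as E2.
    (* From [13 * moment 6 = 3 * moment 2 = 2 * area 1]. *)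
    replace (moment 6) with (2 / 13 * area 1) by lra. field. lra.
  - pose proof (moment_add4 (8 * k + 6)) as E1. pose proof (moment_add4 (8 * k + 6 + 4)) as E2.
    assert (I1 : INR (8 * k + 6) = 8 * INR k + 6) by (rewrite plus_INR, mult_INR; simpl; ring).
    assert (I2 : INR (8 * k + 6 + 4) = 8 * INR k + 10) by (rewrite plus_INR, I1; simpl; ring).
    rewrite I1 in E1. rewrite I2 in E2.
    replace (8 * S k + 6)%nat with (8 * k + 6 + 4 + 4)%nat by lia.
    assert (Hk := pos_INR k).
    (* Two shifts by 4 give exactly the ratio of consecutive Pochhammer quotients, each factor
       multiplied by 8. *)
    assert (E : moment (8 * k + 6 + 4 + 4)
      = (8 * INR k + 7) * (8 * INR k + 11) / ((8 * INR k + 17) * (8 * INR k + 21)) * moment (8 * k + 6)).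
    { apply (Rmult_eq_reg_l ((8 * INR k + 17) * (8 * INR k + 21))); [|nra].
      transitivity ((8 * INR k + 7) * (8 * INR k + 11) * moment (8 * k + 6)); [|field; lra].
      transitivity ((8 * INR k + 17) * ((8 * INR k + 11) * moment (8 * k + 6 + 4))); [|nra].
      nra. }
    rewrite E.
    transitivity ((8 * INR k + 7) * (8 * INR k + 11) / ((8 * INR k + 17) * (8 * INR k + 21))
      * (- / (6 * area 1) * moment (8 * k + 6))); [|ring].
    rewrite <- IH.
    pose proof (rising_fact_pos (9 / 8) (S k) ltac:(lra)).
    pose proof (rising_fact_pos (13 / 8) (S k) ltac:(lra)).
    change (rising_fact ?a (S (S k))) with (rising_fact a (S k) * (a + INR (S k))).
    rewrite S_INR. field. repeat split; lra.
Qed.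

(* The binomial coefficients of [(1 + x)^(-1/4)]. *)
Definition coef (k : nat) : R := (- 1) ^ k * (rising_fact (1 / 4) k / rising_fact 1 k).

Lemma coef_S (k : nat) : coef (S k) * (INR k + 1) = - (INR k + 1 / 4) * coef k.
Proof.
  unfold coef. pose proof (rising_fact_pos 1 k ltac:(lra)). pose proof (pos_INR k).
  simpl. field. lra.
Qed.

(** Consecutive coefficients have ratio [(k + 1/4) / (k + 1)] in absolute value. *)
Lemma Rabs_coef_le_1 (k : nat) : Rabs (coef k) <= 1.
Proof.
  induction k as [|k IH].
  - unfold coef. simpl. rewrite Rabs_pos_eq; lra.
  - pose proof (coef_S k) as E. pose proof (pos_INR k).
    apply Rabs_le_between in IH. apply Rabs_le. nra.
Qed.

(** * Partial sums of the binomial series and their remainders *)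

Definition psum (N : nat) (x : R) : R := sum_n (fun k => coef k * x ^ k) N.
Definition dpsum (N : nat) (x : R) : R := sum_n (fun k => INR k * coef k * x ^ pred k) N.

Lemma psum_S (N : nat) (x : R) : psum (S N) x = psum N x + coef (S N) * x ^ S N.
Proof. apply (sum_Sn (G := R_AbelianMonoid)). Qed.

Lemma dpsum_S (N : nat) (x : R) :
  dpsum (S N) x = dpsum N x + (INR N + 1) * coef (S N) * x ^ N.
Proof. rewrite <- S_INR. apply (sum_Sn (G := R_AbelianMonoid)). Qed.

Lemma is_derive_psum (N : nat) (x : R) : is_derive (psum N) x (dpsum N x).
Proof.
  apply (is_derive_sum_n (V := R_NormedModule) (fun k x => coef k * x ^ k) N x
    (fun k => INR k * coef k * x ^ pred k)).
  intros k _. auto_derive; [trivial|]. ring.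
Qed.

(** The full series solves [(1 + x) f' + f / 4 = 0]. By [coef_S] the coefficients cancel below the
    top degree, so truncation leaves one term. *)
Lemma psum_ode (N : nat) (x : R) :
  (1 + x) * dpsum N x + psum N x / 4 = (INR N + 1 / 4) * coef N * x ^ N.
Proof.
  induction N as [|N IH].
  - unfold dpsum, psum. rewrite !sum_O. simpl. field.
  - rewrite psum_S, dpsum_S.
    transitivity ((1 + x) * dpsum N x + psum N x / 4
      + (coef (S N) * (INR N + 1)) * x ^ N + (INR N + 1 + 1 / 4) * coef (S N) * x ^ S N).
    + simpl. field.
    + rewrite IH, coef_S, S_INR. ring.
Qed.

(** Nested square roots make [/ root4 (y^8 / 4)] agree with [binom_weight y] by definition. *)
Definition root4 (x : R) : R := sqrt (sqrt (1 + x)).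

Lemma root4_bounds (x : R) : 0 <= x -> 1 <= root4 x <= 1 + x.
Proof.
  intros Hx. unfold root4.
  assert (H1 : 1 <= sqrt (1 + x)) by (rewrite <- sqrt_1 at 1; apply sqrt_le_1_alt; lra).
  assert (H2 : 1 <= sqrt (sqrt (1 + x))) by (rewrite <- sqrt_1 at 1; apply sqrt_le_1_alt; lra).
  assert (E1 := sqrt_sqrt (1 + x) ltac:(lra)).
  assert (E2 := sqrt_sqrt (sqrt (1 + x)) ltac:(lra)).
  split; nra.
Qed.

Lemma is_derive_root4 (x : R) : 0 <= x -> is_derive root4 x (root4 x / (4 * (1 + x))).
Proof.
  intros Hx.
  assert (H1 : 0 < sqrt (1 + x)) by (apply sqrt_lt_R0; lra).
  assert (H2 : 0 < sqrt (sqrt (1 + x))) by (apply sqrt_lt_R0; lra).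
  assert (E1 := sqrt_sqrt (1 + x) ltac:(lra)).
  assert (E2 := sqrt_sqrt (sqrt (1 + x)) ltac:(lra)).
  rewrite <- E1. unfold root4. auto_derive.
  - repeat split; lra.
  - set (b := sqrt (sqrt (1 + x))) in *. rewrite <- E2. field. lra.
Qed.

(** By [psum_ode], the product [psum N * root4] has a derivative of order [z^N], and it equals 1 at
    0. The mean value theorem on [[0, x]] bounds its distance from 1. *)
Lemma psum_root4_remainder (N : nat) (x : R) : 0 <= x ->
  Rabs (psum N x - / root4 x) <= (INR N + 1) * x ^ S N.
Proof.
  intros Hx. pose proof (pos_INR N) as HN.
  destruct (MVT_gen (fun z => psum N z * root4 z) 0 x
    (fun z => root4 z / (1 + z) * ((INR N + 1 / 4) * coef N * z ^ N))) as [c [Hc Ec]].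
  - intros z Hz. rewrite Rmin_left, Rmax_right in Hz by lra.
    rewrite <- psum_ode.
    pose proof (is_derive_psum N z) as D1. pose proof (is_derive_root4 z ltac:(lra)) as D2.
    auto_derive.
    + repeat split; eexists; eassumption.
    + rewrite (is_derive_unique (fun x : R => psum N x) _ _ D1).
      rewrite (is_derive_unique (fun x : R => root4 x) _ _ D2). field. lra.
  - intros z Hz. rewrite Rmin_left, Rmax_right in Hz by lra.
    apply continuity_pt_filterlim. apply continuous_Rmult; apply continuous_of_ex_derive; eexists;
      [apply is_derive_psum | apply is_derive_root4; lra].
  - rewrite Rmin_left, Rmax_right in Hc by lra.
    assert (P0 : psum N 0 * root4 0 = 1).
    { assert (psum N 0 = 1).
      { clear. induction N as [|N IH].
        - unfold psum. rewrite sum_O. unfold coef. simpl. field.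
        - rewrite psum_S, IH. simpl. ring. }
      rewrite H. unfold root4. rewrite Rplus_0_r, !sqrt_1. ring. }
    cbv beta in Ec. rewrite P0, Rminus_0_r in Ec.
    pose proof (root4_bounds x Hx) as Hr. pose proof (root4_bounds c ltac:(lra)) as Hrc.
    assert (Hcx : 0 <= c ^ N <= x ^ N) by (split; [apply pow_le; lra | apply pow_incr; lra]).
    replace (psum N x - / root4 x) with ((psum N x * root4 x - 1) * / root4 x) by (field; lra).
    rewrite Ec.
    assert (B1 : 0 <= / root4 x <= 1).
    { split; [left; apply Rinv_0_lt_compat; lra|]. rewrite <- Rinv_1. apply Rinv_le_contravar; lra. }
    assert (B2 : 0 <= root4 c / (1 + c) <= 1).
    { split; [apply Rdiv_le_0_compat; lra|]. apply Rle_div_l; lra. }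
    pose proof (Rabs_coef_le_1 N) as B3. pose proof (Rabs_pos (coef N)).
    rewrite !Rabs_mult, (Rabs_pos_eq (/ root4 x)), (Rabs_pos_eq (root4 c / (1 + c))),
      (Rabs_pos_eq (c ^ N)), (Rabs_pos_eq x), (Rabs_pos_eq (INR N + 1 / 4)) by lra.
    replace ((INR N + 1) * x ^ S N) with (1 * ((INR N + 1) * 1 * x ^ N) * x * 1) by (simpl; ring).
    repeat first [lra | apply Rmult_le_compat | apply Rmult_le_pos].
Qed.

(** The operator [40 x d/dx + 7] produces the weight [40 k + 7]. Eliminating [dpsum] by [psum_ode]
    avoids a separate estimate for the derivative; the three resulting errors give
    [57 = 40 + 10 + 7]. *)
Lemma weighted_psum_remainder (N : nat) (x : R) : 0 <= x <= 1 / 4 ->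
  Rabs (40 * x * dpsum N x + 7 * (psum N x - 1)
        - (- 10 * x * / root4 x / (1 + x) + 7 * (/ root4 x - 1)))
  <= 57 * ((INR N + 1) * x ^ S N).
Proof.
  intros Hx. pose proof (psum_ode N x) as O.
  pose proof (psum_root4_remainder N x ltac:(lra)) as B.
  pose proof (Rabs_coef_le_1 N) as Bc. pose proof (pos_INR N) as HN.
  set (d := psum N x - / root4 x) in *.
  set (E := (INR N + 1) * x ^ S N) in *.
  assert (HE : 0 <= E) by (apply Rmult_le_pos; [lra | apply pow_le; lra]).
  assert (Hd : dpsum N x = ((INR N + 1 / 4) * coef N * x ^ N - psum N x / 4) / (1 + x)).
  { rewrite <- O. field. lra. }
  replace (_ - _) with (40 * ((INR N + 1 / 4) * x ^ S N * coef N) / (1 + x) + - (10 * x / (1 + x) * d) + 7 * d)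
    by (rewrite Hd; unfold d; pose proof (root4_bounds x ltac:(lra)); simpl; field; lra).
  eapply Rle_trans; [apply Rabs_triang|]. eapply Rle_trans; [apply Rplus_le_compat_r, Rabs_triang|].
  assert (B1 : 0 <= / (1 + x) <= 1).
  { split; [left; apply Rinv_0_lt_compat; lra|]. rewrite <- Rinv_1. apply Rinv_le_contravar; lra. }
  assert (Hp : 0 <= x ^ S N) by (apply pow_le; lra).
  assert (T1 : Rabs (40 * ((INR N + 1 / 4) * x ^ S N * coef N) / (1 + x)) <= 40 * E).
  { unfold Rdiv at 1. rewrite !Rabs_mult, (Rabs_pos_eq (/ (1 + x))), (Rabs_pos_eq (x ^ S N)),
      (Rabs_pos_eq 40), (Rabs_pos_eq (INR N + 1 / 4)) by lra.
    pose proof (Rabs_pos (coef N)).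
    assert ((INR N + 1 / 4) * x ^ S N * Rabs (coef N) <= E * 1).
    { apply Rmult_le_compat; try lra; [apply Rmult_le_pos; lra|].
      apply Rmult_le_compat_r; lra. }
    assert (0 <= (INR N + 1 / 4) * x ^ S N * Rabs (coef N)) by (repeat first [lra | apply Rmult_le_pos]).
    nra. }
  assert (T2 : Rabs (- (10 * x / (1 + x) * d)) <= 10 * E).
  { rewrite Rabs_Ropp, Rabs_mult.
    assert (0 <= 10 * x / (1 + x) <= 10).
    { unfold Rdiv. split; [repeat first [lra | apply Rmult_le_pos] | nra]. }
    rewrite (Rabs_pos_eq (10 * x / (1 + x))) by lra.
    apply Rmult_le_compat; try lra. apply Rabs_pos. }
  assert (T3 : Rabs (7 * d) <= 7 * E) by (rewrite Rabs_mult, (Rabs_pos_eq 7); lra).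
  lra.
Qed.

(* Partial sums of [closed_sum]; the [k = 0] term of the series is left out, being the only one
   whose Beta integral diverges. *)
Definition bsum (N : nat) (y : R) : R :=
  sum_n (fun k => coef (S k) * (40 * INR (S k) + 7) * (/ 4) ^ S k * y ^ (8 * k + 6)) N.

(** Since [y^2 * y^(8k+6) = (y^8)^(k+1)], the factor [y^2] turns [bsum] into a sum of powers of
    [x = y^8 / 4]. Subtracting 1 from [psum] drops the term of index 0, and the index shift gives
    [S N]. *)
Lemma sqr_mul_bsum (N : nat) (y : R) :
  y ^ 2 * bsum N y
  = 40 * (y ^ 8 / 4) * dpsum (S N) (y ^ 8 / 4) + 7 * (psum (S N) (y ^ 8 / 4) - 1).
Proof.
  assert (P : forall k, y ^ 2 * ((/ 4) ^ S k * y ^ (8 * k + 6)) = (y ^ 8 / 4) ^ S k).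
  { intros k. unfold Rdiv. rewrite Rpow_mult_distr, <- pow_mult.
    replace (8 * S k)%nat with (2 + (8 * k + 6))%nat by lia. rewrite (pow_add y 2). ring. }
  induction N as [|N IH].
  - unfold bsum. rewrite sum_O, dpsum_S, psum_S. unfold dpsum, psum. rewrite !sum_O.
    specialize (P O). simpl in *. unfold coef. simpl. lra.
  - assert (B : bsum (S N) y = bsum N y
        + coef (S (S N)) * (40 * INR (S (S N)) + 7) * (/ 4) ^ S (S N) * y ^ (8 * S N + 6))
      by apply (sum_Sn (G := R_AbelianMonoid)).
    rewrite B, Rmult_plus_distr_l, IH, (dpsum_S (S N)), (psum_S (S N)).
    replace (y ^ 2 * (coef (S (S N)) * (40 * INR (S (S N)) + 7) * (/ 4) ^ S (S N) * y ^ (8 * S N + 6)))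
      with (coef (S (S N)) * (40 * INR (S (S N)) + 7) * (y ^ 2 * ((/ 4) ^ S (S N) * y ^ (8 * S N + 6))))
      by ring.
    rewrite P, (S_INR (S N)). change ((y ^ 8 / 4) ^ S (S N)) with (y ^ 8 / 4 * (y ^ 8 / 4) ^ S N). ring.
Qed.

(** * Uniform remainder bound and passage to the integral *)

Lemma succ_le_pow2 (n : nat) : INR n + 1 <= 2 ^ n.
Proof.
  induction n as [|n IH]; [simpl; lra|].
  rewrite S_INR. change (2 ^ S n) with (2 * 2 ^ n). pose proof (pos_INR n). lra.
Qed.

(** For [y] nonzero, [y^2] cancels from the remainder bound at [x = y^8 / 4 <= 1/4], and [2^(N+1)]
    absorbs the linear factor. At [y = 0] both functions vanish. *)
Lemma bsum_remainder (N : nat) (y : R) : 0 <= y <= 1 ->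
  Rabs (bsum N y - closed_sum y) <= 57 * (/ 2) ^ N.
Proof.
  intros Hy.
  assert (0 < (/ 2) ^ N) by (apply pow_lt; lra).
  destruct (Req_dec y 0) as [->|Hy0].
  - replace (bsum N 0 - closed_sum 0) with 0.
    + rewrite Rabs_R0. lra.
    + assert (bsum N 0 = 0).
      { unfold bsum. rewrite (sum_n_ext _ (fun _ => 0)).
        - induction N; [apply sum_O|]. rewrite sum_Sn, IHN; [apply Rplus_0_l | apply pow_lt; lra].
        - intros k. rewrite pow_i by lia. apply Rmult_0_r. }
      rewrite H0. unfold closed_sum. ring.
  - assert (Hy8 : y ^ 8 <= 1) by (rewrite <- (pow1 8); apply pow_incr; lra).
    pose proof (pow8_nonneg y).
    pose proof (weighted_psum_remainder (S N) (y ^ 8 / 4) ltac:(lra)) as B.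
    assert (Hq : / root4 (y ^ 8 / 4) = binom_weight y) by reflexivity.
    rewrite <- sqr_mul_bsum, Hq, <- cosh_u_sqr in B.
    pose proof (cosh_u_ge_1 y).
    replace (- 10 * (y ^ 8 / 4) * binom_weight y / (cosh_u y * cosh_u y) + 7 * (binom_weight y - 1)) with (y ^ 2 * closed_sum y) in B
      by (rewrite sqr_mul_closed_sum; field; lra).
    rewrite <- Rmult_minus_distr_l, Rabs_mult, (Rabs_pos_eq (y ^ 2)) in B by apply pow2_ge_0.
    assert (0 < y ^ 2) by (apply pow_lt; lra).
    apply (Rmult_le_reg_l (y ^ 2)); [assumption|].
    eapply Rle_trans; [exact B|].
    (* One factor [y^2] is kept for the cancellation; the remaining power of [y] is at most 1. *)
    assert (E : (y ^ 8 / 4) ^ S (S N) <= y ^ 2 * (/ 4) ^ S (S N)).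
    { unfold Rdiv. rewrite Rpow_mult_distr, <- pow_mult.
      apply Rmult_le_compat_r; [apply pow_le; lra|].
      replace (8 * S (S N))%nat with (2 + (8 * N + 14))%nat by lia. rewrite (pow_add y 2).
      rewrite <- (Rmult_1_r (y ^ 2)) at 2. apply Rmult_le_compat_l; [lra|].
      rewrite <- (pow1 (8 * N + 14)). apply pow_incr; lra. }
    pose proof (succ_le_pow2 (S N)) as P2.
    assert (0 < (/ 4) ^ S (S N)) by (apply pow_lt; lra).
    assert (P4 : 2 ^ S N * (/ 4) ^ S (S N) <= (/ 2) ^ N).
    { replace (/ 4) with (/ 2 * / 2) by field. rewrite Rpow_mult_distr.
      replace (2 ^ S N * ((/ 2) ^ S (S N) * (/ 2) ^ S (S N)))
        with ((2 * / 2) ^ S N * / 2 * (/ 2) ^ S (S N)) by (rewrite Rpow_mult_distr; simpl; ring).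
      replace (2 * / 2) with 1 by field. rewrite pow1. simpl. lra. }
    apply Rle_trans with (57 * (2 ^ S N * (y ^ 2 * (/ 4) ^ S (S N)))); [|nra].
    apply Rmult_le_compat_l; [lra|].
    pose proof (pos_INR (S N)).
    apply Rmult_le_compat; try lra. apply pow_le; lra.
Qed.

Lemma is_RInt_bsum (N : nat) :
  is_RInt (fun y => (1 - y ^ 4) * sqrt_one_minus_pow4 y * bsum N y) 0 1
    (sum_n (fun k => coef (S k) * (40 * INR (S k) + 7) * (/ 4) ^ S k * moment (8 * k + 6)) N).
Proof.
  assert (T : forall k, is_RInt (fun y => (1 - y ^ 4) * sqrt_one_minus_pow4 y
      * (coef (S k) * (40 * INR (S k) + 7) * (/ 4) ^ S k * y ^ (8 * k + 6))) 0 1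
      (coef (S k) * (40 * INR (S k) + 7) * (/ 4) ^ S k * moment (8 * k + 6))).
  { intros k.
    apply (is_RInt_ext (V := R_NormedModule) (fun y => coef (S k) * (40 * INR (S k) + 7) * (/ 4) ^ S k
      * (y ^ (8 * k + 6) * ((1 - y ^ 4) * sqrt_one_minus_pow4 y)))).
    - intros y _. match goal with |- ?a = ?b => change (@eq R a b) end. ring.
    - apply (is_RInt_scal (V := R_NormedModule)), is_RInt_moment. }
  induction N as [|N IH].
  - rewrite sum_O. eapply (is_RInt_ext (V := R_NormedModule)); [|apply (T O)].
    intros y _. unfold bsum. rewrite sum_O. reflexivity.
  - rewrite sum_Sn. eapply (is_RInt_ext (V := R_NormedModule));
      [|apply (is_RInt_plus (V := R_NormedModule) _ _ _ _ _ _ IH (T (S N)))].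
    intros y _. unfold bsum. rewrite sum_Sn. symmetry. apply Rmult_plus_distr_l.
Qed.

(** The weight [(1 - y^4)^(3/2)] lies between 0 and 1 on an interval of length 1, so the uniform
    bound passes to the integral. *)
Lemma bsum_integral_remainder (N : nat) :
  Rabs (sum_n (fun k => coef (S k) * (40 * INR (S k) + 7) * (/ 4) ^ S k * moment (8 * k + 6)) N
        - 6 * area 1 * (7 - 5 * sqrt 2)) <= 57 * (/ 2) ^ N.
Proof.
  pose proof (is_RInt_minus (V := R_NormedModule) _ _ _ _ _ _ (is_RInt_bsum N) is_RInt_closed_sum) as I.
  pose proof (is_RInt_unique _ _ _ _ I) as U.
  change (minus ?a ?b) with (a - b) in U. rewrite <- U.
  replace (57 * (/ 2) ^ N) with ((1 - 0) * (57 * (/ 2) ^ N)) by ring.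
  apply abs_RInt_le_const; [lra | eexists; exact I |].
  intros y Hy. change (minus ?a ?b) with (a - b).
  rewrite <- Rmult_minus_distr_l, Rabs_mult.
  rewrite <- (Rmult_1_l (57 * (/ 2) ^ N)).
  assert (0 <= y ^ 4 <= 1) by (split; [apply pow_le | rewrite <- (pow1 4); apply pow_incr]; lra).
  assert (0 <= sqrt_one_minus_pow4 y <= 1).
  { split; [apply sqrt_pos|]. rewrite <- sqrt_1. apply sqrt_le_1_alt. lra. }
  apply Rmult_le_compat; try apply Rabs_pos.
  - rewrite Rabs_pos_eq; nra.
  - apply bsum_remainder, Hy.
Qed.

Theorem mainTheorem9 :
  is_series
    (fun k : nat =>
       (- (1 / 4)) ^ k
       * ((rising_fact (- (1 / 8)) k * rising_fact (1 / 4) k * rising_fact (3 / 8) k)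
          / (rising_fact 1 k * rising_fact (9 / 8) k * rising_fact (13 / 8) k))
       * (40 * INR k + 7))
    (5 * sqrt 2).
Proof.
  pose proof area_1_pos as HA.
  apply is_series_decr_1.
  (* The removed term of index 0 is 7, and [kappa] times the integral of the closed form is
     [5 * sqrt 2 - 7]. *)
  set (kappa := - / (6 * area 1)).
  replace (plus _ _) with (kappa * (6 * area 1 * (7 - 5 * sqrt 2))).
  2:{ unfold plus, opp, kappa; simpl. field. lra. }
  apply (is_series_ext (fun k => kappa
    * (coef (S k) * (40 * INR (S k) + 7) * (/ 4) ^ S k * moment (8 * k + 6)))).
  { intros k. pose proof (rising_fact_ratio_moment k) as E. fold kappa in E.
    match goal with |- ?a = ?b => change (@eq R a b) end.
    pose proof (rising_fact_pos 1 (S k) ltac:(lra)).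
    pose proof (rising_fact_pos (9 / 8) (S k) ltac:(lra)).
    pose proof (rising_fact_pos (13 / 8) (S k) ltac:(lra)).
    transitivity (coef (S k) * (/ 4) ^ S k * (kappa * moment (8 * k + 6)) * (40 * INR (S k) + 7)); [ring|].
    rewrite <- E. unfold coef.
    replace (- (1 / 4)) with (- 1 * / 4) by field. rewrite Rpow_mult_distr.
    field. lra. }
  apply (is_series_scal (V := R_NormedModule) kappa).
  set (a := fun k => coef (S k) * (40 * INR (S k) + 7) * (/ 4) ^ S k * moment (8 * k + 6)).
  set (l := 6 * area 1 * (7 - 5 * sqrt 2)).
  assert (G : is_lim_seq (fun N => 57 * (/ 2) ^ N) 0).
  { rewrite <- (Rmult_0_r 57) at 1. apply (is_lim_seq_scal_l _ 57 0), is_lim_seq_geom.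
    rewrite Rabs_pos_eq; lra. }
  change (is_lim_seq (sum_n a) l).
  (* The geometric error bound squeezes the partial sums to [l]. *)
  apply (is_lim_seq_le_le (fun N => l - 57 * (/ 2) ^ N) _ (fun N => l + 57 * (/ 2) ^ N)).
  - intros N. pose proof (bsum_integral_remainder N) as B. apply Rabs_le_between in B.
    fold a l in B. lra.
  - rewrite <- (Rminus_0_r l) at 1. apply is_lim_seq_minus'; [apply is_lim_seq_const | exact G].
  - rewrite <- (Rplus_0_r l) at 1. apply is_lim_seq_plus'; [apply is_lim_seq_const | exact G].
Qed.
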